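(* Let $(\mathfrak{g},\bullet_{\mathfrak{g}},\langle\;,\;\rangle_{\mathfrak{g}})$ be an $\mathrm{L}$-quadratic symmetric Leibniz algebra with $(\mathfrak{h},[\;,\;]_{\mathfrak{h}})$ and $(A,\bullet_A,\langle\;,\;\rangle_A)$ its core. Then $\mathrm{Leib}(\mathfrak{g})\subset\mathrm{Leib}(\mathfrak{g})^\perp$, $(A,\bullet_A,\langle\;,\;\rangle_A)$ is a quadratic Lie algebra (with bracket denoted $[\;,\;]_A$), $(\mathfrak{h},[\;,\;]_{\mathfrak{h}})$ is abelian, and $(\mathfrak{g},\bullet_{\mathfrak{g}},\langle\;,\;\rangle_{\mathfrak{g}})$ is isomorphic to $(\mathfrak{h}\oplus A\oplus\mathfrak{h}^*,\bullet,\langle\;,\;\rangle_n)$ where, for any $X,Y\in\mathfrak{h}$, $a,b\in A$, the non-vanishing products are $$\begin{cases}X\bullet Y=\theta(X,Y)+\Omega(X)^\flat(Y),\quad a\bullet b=[a,b]_A+\mu(a,b),\\ X\bullet a=F(X)a+\nu(X,a),\quad a\bullet X=-F(X)a+\rho(a,X),\end{cases}$$ where $F:\mathfrak{h}\to\mathrm{so}(A)\cap\mathrm{Der}(A)$, $\Omega:\mathfrak{h}\to\wedge^2\mathfrak{h}^*$ are linear, $\theta,\omega:\mathfrak{h}\times\mathfrak{h}\to A$ are bilinear skew-symmetric, and $\mu,\rho,\nu$ are the $\mathfrak{h}^*$-valued bilinear maps defined by $$\rho(a,X)(Y)=-\langle\omega(X,Y),a\rangle_A,\quad \mu(a,b)(X)=\langle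 F(X)a,b\rangle_A,\quad \nu(X,a)(Y)=-\langle\theta(X,Y),a\rangle_A.$$ Moreover, $(F,\omega,\theta,\Omega)$ satisfy, for any $X,Y,Z,T\in\mathfrak{h}$, $$\begin{cases} \mathrm{ad}^A_{\theta(X,Y)}=-\mathrm{ad}^A_{\omega(X,Y)}=[F(X),F(Y)],\\ F(X)\theta(Y,Z)+F(Y)\theta(Z,X)+F(Z)\theta(X,Y)=0,\\ F(X)\left[\theta(Y,Z)+\omega(Y,Z)\right]=0,\\ \langle\theta(Y,T),\theta(Z,X)\rangle_A+\langle\theta(X,T),\theta(Y,Z)\rangle_A+\langle\theta(Z,T),\theta(X,Y)\rangle_A=0,\\ \langle\theta(X,T)+\omega(X,T),\theta(Y,Z)\rangle_A=0. \end{cases}$$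
   Context: Algebras are real and finite dimensional. A symmetric Leibniz algebra is both left Leibniz ($u\bullet(v\bullet w)=(u\bullet v)\bullet w+v\bullet(u\bullet w)$) and right Leibniz ($(v\bullet w)\bullet u=(v\bullet u)\bullet w+v\bullet(w\bullet u)$). A metric is a nondegenerate symmetric bilinear form; an algebra with a metric is $\mathrm{L}$-quadratic if every left multiplication is skew-symmetric. A quadratic Lie algebra is a Lie algebra with a metric for which every $\mathrm{ad}_u$ is skew-symmetric. $\mathrm{Leib}(\mathfrak{g})=\mathrm{span}\{u\bullet v+v\bullet u\}$. Isomorphic means by a linear bijection preserving product and metric. Core of an $\mathrm{L}$-quadratic left Leibniz algebra: put $I=\mathrm{Leib}(\mathfrak{g})\cap\mathrm{Leib}(\mathfrak{g})^\perp$; then $A=I^\perp/I$ with product and metric induced from $I^\perp$, and $\mathfrak{h}=\mathfrak{g}/I^\perp$ with the quotient product, which is a Lie bracket ($I^\perp$ is an ideal). Notation: $\mathrm{Der}(A)$ derivations and $\mathrm{so}(A)$ skew-symmetric endomorphisms of $A$; $[F(X),F(Y)]$ is the commutator; $\langle X+a+\alpha,X+a+\alpha\rangle_n=2\alpha(X)+\langle a,a\rangle_A$ for $X\in\mathfrak{h}$, $a\in A$, $\alpha\in\mathfrak{h}^*$; for $\sigma\in\wedge^2\mathfrak{h}^*$, $\sigma^\flat(X)(Y)=\sigma(X,Y)$. ''Non-vanishing products'' means products of elements of the summands not listed are zero. *)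

(* Defs.v *)
From HB Require Import structures.
From mathcomp Require Import all_boot all_order all_algebra.
From mathcomp Require Import boolp classical_sets reals.

Set Implicit Arguments.
Unset Strict Implicit.
Unset Printing Implicit Defensive.

Import GRing.Theory.
Local Open Scope ring_scope.
Local Open Scope quotient_scope.

Section Span.
Context (K : fieldType) (V : vectType K).
Local Open Scope classical_set_scope.

Definition span_of (S : set V) (U : {vspace V}) :=
  (forall x, S x -> x \in U) /\
  (forall W : {vspace V}, (forall x, S x -> x \in W) -> (U <= W)%VS).

Definition spanset (S : set V) : {vspace V} := xget 0%VS (span_of S).

Lemma spansetP (S : set V) : span_of S (spanset S).
Proof.
rewrite /spanset; case: xgetP => [U _ // | noU]; exfalso.
pose dims n := `[< exists2 U : {vspace V},
  \dim U = n & forall x, S x -> x \in U >].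
have exd : exists n, dims n.
  by exists (\dim {: V}); apply/asboolP; exists fullv => // x _; rewrite memvf.
have [_ /asboolP[U <- SU] minU] := ex_minnP exd.
apply: (noU U); split=> // W SW; apply/capv_idPl/eqP.
rewrite eqEdim capvSl /=; apply: minU; apply/asboolP; exists (U :&: W)%VS => //.
by move=> x Sx; rewrite memv_cap SU // SW.
Qed.

End Span.

Section QuotientSpace.
Context (K : fieldType) (V : vectType K) (U : {vspace V}).

Definition quotv := Quotient.quot U.

HB.instance Definition _ := GRing.Zmodule.on quotv.

Definition qproj (x : V) : quotv := \pi_quotv x.
Definition qrepr (x : quotv) : V := repr x.

Lemma qreprK : cancel qrepr qproj. Proof. exact: reprK. Qed.

Lemma eq_qproj x y : (qproj x == qproj y) = (x - y \in U).
Proof. by rewrite Quotient.idealrBE. Qed.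

Lemma qprojK x : qrepr (qproj x) - x \in U.
Proof. by rewrite -eq_qproj qreprK. Qed.

Lemma qproj_is_zmod_morphism : zmod_morphism qproj.
Proof. exact: (@raddfB V (Quotient.quot U) \pi_(Quotient.quot U)). Qed.
HB.instance Definition _ :=
  GRing.isZmodMorphism.Build V quotv qproj qproj_is_zmod_morphism.

Definition qscale (k : K) (x : quotv) : quotv := qproj (k *: qrepr x).

Lemma qproj_scale k x : qproj (k *: x) = qscale k (qproj x).
Proof.
by apply/eqP; rewrite eq_sym /qscale eq_qproj -scalerBr memvZ ?qprojK.
Qed.

Fact qscalerA k l x : qscale k (qscale l x) = qscale (k * l) x.
Proof. by rewrite -[x]qreprK -!qproj_scale scalerA. Qed.
Fact qscale1r : left_id 1 qscale.
Proof. by move=> x; rewrite -[x]qreprK -!qproj_scale scale1r. Qed.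
Fact qscalerDr : right_distributive qscale +%R.
Proof.
move=> k x y; rewrite -[x]qreprK -[y]qreprK -raddfD -!qproj_scale.
by rewrite scalerDr raddfD.
Qed.
Fact qscalerDl x : {morph qscale^~ x : k l / k + l}.
Proof.
by move=> k l; rewrite -[x]qreprK -!qproj_scale scalerDl raddfD.
Qed.

HB.instance Definition _ := GRing.Zmodule_isLmodule.Build K quotv
  qscalerA qscale1r qscalerDr qscalerDl.

Fact qproj_is_scalable : scalable qproj.
Proof. by move=> k x; rewrite qproj_scale. Qed.
HB.instance Definition _ :=
  GRing.isScalable.Build K V quotv *:%R qproj qproj_is_scalable.

Fact quotv_vect_iso : Vector.axiom (\dim U^C) quotv.
Proof.
pose p := daddv_pi U^C U.
have UC0 : (U^C :&: U = 0)%VS by rewrite capvC capv_compl.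
have pU x : x \in U -> p x = 0.
  move=> xU; have := daddv_pi_add UC0 (_ : x \in U^C + U)%VS.
  rewrite addvC addv_complf memvf => /(_ isT).
  have -> : daddv_pi U U^C x = x by rewrite daddv_pi_id // capv_compl.
  by rewrite -{3}[x]add0r => /addIr.
have pB x : x - p x \in U.
  have := daddv_pi_add UC0 (_ : x \in U^C + U)%VS.
  rewrite addvC addv_complf memvf => /(_ isT) {1}<-.
  by rewrite addrAC subrr add0r memv_pi.
have prepr x : p (qrepr (qproj x)) = p x.
  by apply/eqP; rewrite -subr_eq0 -linearB; apply/eqP/pU/qprojK.
have pD (k : K) x y :
    p (qrepr (k *: x + y)) = k *: p (qrepr x) + p (qrepr y).
  by rewrite -[x]qreprK -[y]qreprK -linearP !prepr linearP.
exists (fun x => \row_i coord (vbasis U^C) i (p (qrepr x))).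
  by move=> k x y; apply/rowP=> i; rewrite !mxE pD linearP.
exists (fun r : 'rV_(\dim U^C) => qproj (\sum_i r 0 i *: (vbasis U^C)`_i)).
  move=> x /=; rewrite -[RHS]qreprK.
  have pin : p (qrepr x) \in (U^C)%VS by exact: memv_pi.
  have -> : \sum_i (\row_i0 coord (vbasis U^C) i0 (p (qrepr x))) 0 i
      *: (vbasis U^C)`_i = p (qrepr x).
    by rewrite [RHS](coord_vbasis pin); apply: eq_bigr => i _; rewrite mxE.
  by apply/eqP; rewrite eq_sym eq_qproj.
move=> r; apply/rowP=> i; rewrite mxE prepr daddv_pi_id //.
  by rewrite coord_sum_free ?(basis_free (vbasisP _)).
by apply: rpred_sum => j _; rewrite rpredZ ?vbasis_mem ?memt_nth.
Qed.

HB.instance Definition _ := Lmodule_hasFinDim.Build K quotv quotv_vect_iso.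

End QuotientSpace.

Section QuotientStructure.
Context (K : fieldType) (V : vectType K) (U : {vspace V}).

Definition two_sided_ideal (m : V -> V -> V) (W : {vspace V}) :=
  forall x u, u \in W -> (m x u \in W) /\ (m u x \in W).

Context (m : {bilinear V -> V -> V}).

Definition quot_mul (idU : two_sided_ideal m U) (x y : quotv U) : quotv U :=
  qproj U (m (qrepr x) (qrepr y)).

Lemma quot_mulE idU x y :
  quot_mul idU (qproj U x) (qproj U y) = qproj U (m x y).
Proof.
apply/eqP; rewrite eq_qproj.
set x' := qrepr _; set y' := qrepr _.
have -> : m x' y' - m x y = m (x' - x) y' + m x (y' - y).
  by rewrite linearBl linearBr addrA subrK.
by rewrite memvD //; [case: (idU y' _ (qprojK U x)) | case: (idU x _ (qprojK U y))].
Qed.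

Fact quot_mul_bilinear idU : bilinear_for *:%R *:%R (quot_mul idU).
Proof.
split=> z k x y; rewrite -[x]qreprK -[y]qreprK -[z]qreprK -linearP !quot_mulE.
  by rewrite linearPl linearP.
by rewrite linearPr linearP.
Qed.

HB.instance Definition _ idU := bilinear_isBilinear.Build K
  (quotv U) (quotv U) (quotv U) *:%R *:%R (quot_mul idU) (quot_mul_bilinear idU).

Context (b : {symmetric V}).

Lemma symC x y : b x y = b y x.
Proof. by rewrite hermC /= expr0 mul1r. Qed.

Definition quot_form (radU : (U <= orthov b fullv)%VS) (x y : quotv U) : K :=
  b (qrepr x) (qrepr y).

Lemma quot_formE radU x y : quot_form radU (qproj U x) (qproj U y) = b x y.
Proof.
have rad u v : u \in U -> b u v = 0.
  by move=> /(subvP radU)/mem_orthovP; apply; rewrite memvf.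
rewrite /quot_form; set x' := qrepr _; set y' := qrepr _.
apply/eqP; rewrite -subr_eq0.
have -> : b x' y' - b x y = b (x' - x) y' + b x (y' - y).
  by rewrite linearBl linearBr addrA subrK.
by rewrite (symC x) !rad ?addr0 ?qprojK.
Qed.

Fact quot_form_bilinear radU :
  bilinear_for *%R (idfun \; *%R) (quot_form radU).
Proof.
split=> z k x y; rewrite -[x]qreprK -[y]qreprK -[z]qreprK -linearP !quot_formE.
  by rewrite linearPl.
by rewrite linearPr.
Qed.

HB.instance Definition _ radU := bilinear_isBilinear.Build K
  (quotv U) (quotv U) K *%R (idfun \; *%R)
  (quot_form radU) (quot_form_bilinear radU).

Fact quot_form_sym radU x y :
  quot_form radU x y = (-1) ^+ false * idfun (quot_form radU y x).
Proof. by rewrite expr0 mul1r /quot_form /= symC. Qed.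

HB.instance Definition _ radU := isHermitianSesquilinear.Build K
  (quotv U) false idfun (quot_form radU) (quot_form_sym radU).

End QuotientStructure.

Section Identities.
Context (K : fieldType) (V : vectType K).

Definition left_leibniz (m : V -> V -> V) :=
  forall u v w, m u (m v w) = m (m u v) w + m v (m u w).

Definition right_leibniz (m : V -> V -> V) :=
  forall u v w, m (m v w) u = m (m v u) w + m v (m w u).

Definition symmetric_leibniz (m : V -> V -> V) :=
  left_leibniz m /\ right_leibniz m.

Definition lie_bracket (m : {bilinear V -> V -> V}) :=
  (forall u, m u u = 0) /\
  (forall u v w, m u (m v w) + m v (m w u) + m w (m u v) = 0).

Definition derivation (m : V -> V -> V) (f : V -> V) :=
  forall u v, f (m u v) = m (f u) v + m u (f v).

Definition skew_endo (b : V -> V -> K) (f : V -> V) :=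
  forall u v, b (f u) v = - b u (f v).

Definition quadratic_lie (m : {bilinear V -> V -> V}) (b : {symmetric V}) :=
  [/\ lie_bracket m, nondegenerate b & forall u, skew_endo b (m u)].

Definition leib (m : V -> V -> V) : {vspace V} :=
  spanset [set x | exists u v, x = m u v + m v u]%classic.

End Identities.

Definition isometric_iso (K : fieldType) (V W : vectType K)
    (mV : V -> V -> V) (bV : V -> V -> K) (mW : W -> W -> W) (bW : W -> W -> K) :=
  exists f : 'Hom(V, W), [/\ bijective f,
    forall u v, f (mV u v) = mW (f u) (f v) &
    forall u v, bW (f u) (f v) = bV u v].

Record lquad_leibniz (R : realType) := LQuadLeibniz {
  carrier :> vectType R;
  lmul : {bilinear carrier -> carrier -> carrier};
  metric : {symmetric carrier};
  metric_nondeg : nondegenerate metric;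
  lmul_left_leibniz : left_leibniz lmul;
  lmul_skew : forall u, skew_endo metric (lmul u)
}.

Section Restriction.
Context (K : fieldType) (V : vectType K) (P : {vspace V}).

Definition sub_mul (m : V -> V -> V) (x y : subvs_of P) : subvs_of P :=
  vsproj P (m (vsval x) (vsval y)).

(* [sub_mul] is the restriction of [m] only if [P] is stable under [m]. *)
Lemma sub_mulE (m : V -> V -> V) x y : m (vsval x) (vsval y) \in P ->
  vsval (sub_mul m x y) = m (vsval x) (vsval y).
Proof. exact: vsprojK. Qed.

Fact sub_mul_bilinear (m : {bilinear V -> V -> V}) :
  bilinear_for *:%R *:%R (sub_mul m).
Proof.
split=> z k x y; rewrite /sub_mul linearP.
  by rewrite linearPl linearP.
by rewrite !linearP.
Qed.

HB.instance Definition _ (m : {bilinear V -> V -> V}) :=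
  bilinear_isBilinear.Build K (subvs_of P) (subvs_of P) (subvs_of P)
    *:%R *:%R (sub_mul m) (sub_mul_bilinear m).

Definition sub_form (b : V -> V -> K) (x y : subvs_of P) : K :=
  b (vsval x) (vsval y).

Fact sub_form_bilinear (b : {symmetric V}) :
  bilinear_for *%R (idfun \; *%R) (sub_form b).
Proof.
split=> z k x y; rewrite /sub_form linearP //.
by rewrite linearPl.
Qed.

HB.instance Definition _ (b : {symmetric V}) :=
  bilinear_isBilinear.Build K (subvs_of P) (subvs_of P) K
    *%R (idfun \; *%R) (sub_form b) (sub_form_bilinear b).

Fact sub_form_sym (b : {symmetric V}) x y :
  sub_form b x y = (-1) ^+ false * idfun (sub_form b y x).
Proof. by rewrite expr0 mul1r /sub_form /= symC. Qed.

HB.instance Definition _ (b : {symmetric V}) :=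
  isHermitianSesquilinear.Build K (subvs_of P) false idfun
    (sub_form b) (sub_form_sym b).

End Restriction.

Section Core.
Context (R : realType) (G : lquad_leibniz R).

Local Notation "u *_g v" := (lmul G u v) (at level 40).

Definition core_I : {vspace G} :=
  (leib (lmul G) :&: orthov (metric G) (leib (lmul G)))%VS.

Definition core_Iperp : {vspace G} := orthov (metric G) core_I.

Lemma leib_sum u v : u *_g v + v *_g u \in leib (lmul G).
Proof. by apply: (spansetP _).1; exists u, v. Qed.

Lemma leib_ind (W : {vspace G}) :
  (forall u v, u *_g v + v *_g u \in W) -> (leib (lmul G) <= W)%VS.
Proof. by move=> h; apply: (spansetP _).2 => _ [u [v ->]]. Qed.

Lemma leib_mull u x : x \in leib (lmul G) -> u *_g x \in leib (lmul G).
Proof.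
move=> xL; pose f : 'End(G) := linfun (lmul G u).
suff /subvP/(_ x xL) : (leib (lmul G) <= f @^-1: leib (lmul G))%VS.
  by rewrite -memv_preim lfunE.
apply: leib_ind => v w; rewrite -memv_preim lfunE /= linearDr.
rewrite [u *_g (v *_g w)]lmul_left_leibniz [u *_g (w *_g v)]lmul_left_leibniz.
by rewrite [X in _ + X]addrC addrACA memvD ?leib_sum.
Qed.

Lemma core_I_mull u x : x \in core_I -> u *_g x \in core_I.
Proof.
rewrite !memv_cap => /andP[xL /mem_orthovP xO]; rewrite leib_mull //=.
by apply/mem_orthovP => y yL; rewrite lmul_skew xO ?oppr0 // leib_mull.
Qed.

Lemma core_I_mulr x u : x \in core_I -> x *_g u = 0.
Proof.
rewrite memv_cap => /andP[xL _].
suff /subvP/(_ x xL) : (leib (lmul G) <=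
    lker (linfun (applyr (lmul G) u)))%VS.
  by rewrite memv_ker lfunE => /eqP.
apply: leib_ind => v w; rewrite memv_ker lfunE /= linearDl.
apply/eqP/(addIr (v *_g (w *_g u))).
by rewrite add0r -addrA -(lmul_left_leibniz w v u) -lmul_left_leibniz.
Qed.

Lemma core_Iperp_ideal : two_sided_ideal (lmul G) core_Iperp.
Proof.
have left u w : w \in core_Iperp -> u *_g w \in core_Iperp.
  move=> /mem_orthovP wO; apply/mem_orthovP => l lI.
  by rewrite lmul_skew wO ?oppr0 // core_I_mull.
move=> u w wP; split; first exact: left.
apply/mem_orthovP => l lI.
have -> : w *_g u = (w *_g u + u *_g w) - u *_g w by rewrite addrK.
rewrite linearBl.
have /mem_orthovP/(_ _ lI) e := left u w wP.
rewrite [X in _ - X]e subr0; move: lI; rewrite memv_cap => /andP[_ /mem_orthovP lO].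
exact: etrans (symC (metric G) _ _) (lO _ (leib_sum w u)).
Qed.

Lemma core_Iperp_mul0 w x : w \in core_Iperp -> x \in core_I -> w *_g x = 0.
Proof.
move=> wP xI; have /eqP := metric_nondeg G => nd.
apply/eqP; rewrite -memv0 -nd; apply/mem_orthovP => u _.
rewrite lmul_skew; apply/eqP; rewrite oppr_eq0; apply/eqP; rewrite symC.
by have /mem_orthovP/(_ _ xI) := (core_Iperp_ideal u wP).2.
Qed.

(** [A = I^perp / I]; [core_J] is [I] seen inside the vector space [I^perp]. *)
Definition core_J : {vspace subvs_of core_Iperp} :=
  (linfun (@vsval _ _ core_Iperp) @^-1: core_I)%VS.

Lemma core_J_ideal :
  two_sided_ideal (sub_mul (P := core_Iperp) (lmul G)) core_J.
Proof.
move=> x u; rewrite -!memv_preim !lfunE /= => uI.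
have uP := subvsP u; have xP := subvsP x.
rewrite !sub_mulE; try by case: (core_Iperp_ideal (vsval x) uP).
by rewrite core_Iperp_mul0 // core_I_mulr // !mem0v.
Qed.

Lemma core_J_radical :
  (core_J <= orthov (sub_form (P := core_Iperp) (metric G)) fullv)%VS.
Proof.
apply/subvP => u; rewrite -memv_preim lfunE /= => uI.
apply/mem_orthovP => v _; rewrite symC.
by have /mem_orthovP := subvsP v; apply.
Qed.

Definition coreA : vectType R := quotv core_J.
Definition coreA_mul : {bilinear coreA -> coreA -> coreA} :=
  quot_mul core_J_ideal.
Definition coreA_form : {symmetric coreA} := quot_form core_J_radical.

Definition coreh : vectType R := quotv core_Iperp.
Definition coreh_mul : {bilinear coreh -> coreh -> coreh} :=
  quot_mul core_Iperp_ideal.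

End Core.

Section Model.
Context (R : realType) (h A : vectType R).

Definition dual : vectType R := 'Hom(h, R^o).

(* Bilinear forms on [h] are encoded as elements [s] of ['Hom(h, dual)], with
   [s X Y] the value at [(X, Y)]; hence [s] itself is the map [s^flat]. *)
Definition wedge2 (s : 'Hom(h, dual)) := forall X Y, s X Y = - s Y X.

Context (br : A -> A -> A) (b : {symmetric A}).
Context (F : {linear h -> 'End(A)}) (Omega : {linear h -> 'Hom(h, dual)}).
Context (theta omega : {bilinear h -> h -> A}).

Definition rho (a : A) (X : h) : dual := linfun (fun Y => - b (omega X Y) a : R^o).
Definition mu (a a' : A) : dual := linfun (fun X => b (F X a) a' : R^o).
Definition nu (X : h) (a : A) : dual := linfun (fun Y => - b (theta X Y) a : R^o).

Definition model : vectType R := (h * A * dual)%type.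

Definition model_mul (u v : model) : model :=
  let: (X, a, _) := u in let: (Y, a', _) := v in
  (0, theta X Y + br a a' + F X a' - F Y a,
   Omega X Y + mu a a' + nu X a' + rho a Y).

(* Polarization of [X + a + alpha |-> 2 alpha(X) + <a, a>]. *)
Definition model_form (u v : model) : R :=
  let: (X, a, alpha) := u in let: (Y, a', beta) := v in
  alpha Y + beta X + b a a'.

Lemma model_formE X a alpha :
  model_form (X, a, alpha) (X, a, alpha) = alpha X *+ 2 + b a a.
Proof. by rewrite mulr2n. Qed.

Fact linfunE (f : h -> R^o) : linear f -> linfun f =1 f.
Proof.
move=> lin X; pose lf : {linear h -> R^o} :=
  HB.pack f (GRing.isLinear.Build _ _ _ _ f lin).
exact: (lfunE lf).
Qed.

Lemma rhoE a X Y : rho a X Y = - b (omega X Y) a.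
Proof.
rewrite /rho linfunE // => k Y1 Y2.
by rewrite linearPr linearPl opprD -mulrN.
Qed.

Lemma muE a a' X : mu a a' X = b (F X a) a'.
Proof.
rewrite /mu linfunE // => k X1 X2.
by rewrite linearP add_lfunE scale_lfunE linearPl.
Qed.

Lemma nuE X a Y : nu X a Y = - b (theta X Y) a.
Proof.
rewrite /nu linfunE // => k Y1 Y2.
by rewrite linearPr linearPl opprD -mulrN.
Qed.

End Model.

(* Main.v *)
From HB Require Import structures.
Require Import Defs.
From mathcomp Require Import all_boot all_order all_algebra.
From mathcomp Require Import reals ring lra.
Import GRing.Theory Num.Theory.
Local Open Scope ring_scope.

(** Why the theorem holds.  In any left Leibniz algebra [Leib] acts by zero on
    the left.  Comparing the left and right Leibniz identities gives
    [w (v u) = - (v u) w] (lemma [mul_prod_anticomm]): a product anticommutes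
    with every element, so [Leib] acts by zero on the right too.  As left
    multiplications are skew, [Leib] is then orthogonal to all products; in
    particular it is isotropic, [I = Leib], and [I^perp] contains the products.
    Hence [h = G / I^perp] is abelian, and [A = I^perp / I], where
    antisymmetry is forced, is a quadratic Lie algebra.

    For the isomorphism, choose a linear section [s] of [G -> h] whose image is
    isotropic ([isotropic_section]: correct an arbitrary section by half of its
    Gram form).  An element [u] then has the coordinates
    [(X, class of u - s X, <u, s _>)] with [X = pi u]; the metric takes the
    hyperbolic form in these coordinates, so they are injective, and the Riesz
    representation makes them surjective ([coordinates_isometric_iso]).
    Expanding products in these coordinates dictates the data:
    [theta X Y] is the class of [s X * s Y], [F X] is the action of [s X] on
    [A], [Omega X Y Z = <s X * s Y, s Z>], and [omega X Y] represents the form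
    [a |-> - <a * s X, s Y>] on [A].

    The structure equations are the Leibniz identities on elements of [A] and
    of the image of [s], read either in [A] or through the metric against the
    image of [s].  Identities on [omega], which is only known through the
    metric, are obtained by pairing with elements of [A]. *)

Set Implicit Arguments.
Unset Strict Implicit.
Unset Printing Implicit Defensive.

(** * Multilinear maps and linear sections *)

Section LinearAlgebra.
Context (K : fieldType).

Lemma linear_linfunE (V W : vectType K) (f : V -> W) : linear f -> linfun f =1 f.
Proof.
move=> lin x; pose lf : {linear V -> W} :=
  HB.pack f (GRing.isLinear.Build _ _ _ _ f lin).
exact: (lfunE lf).
Qed.

Lemma bilinear_exists (U V W : lmodType K) (f : U -> V -> W) :
  bilinear_for *:%R *:%R f ->
  exists B : {bilinear U -> V -> W}, forall x y, B x y = f x y.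
Proof.
move=> lin; pose B : {bilinear U -> V -> W} :=
  HB.pack f (bilinear_isBilinear.Build _ _ _ _ _ _ f lin).
by exists B.
Qed.

Lemma bilinear_curry (U : lmodType K) (V W : vectType K) (f : U -> V -> W) :
  bilinear_for *:%R *:%R f ->
  exists F : {linear U -> 'Hom(V, W)}, forall x y, F x y = f x y.
Proof.
move=> [linl linr].
have fE x : linfun (f x) =1 f x by apply/linear_linfunE/linr.
have lin : linear (fun x => linfun (f x)).
  move=> k x y; apply/lfunP=> z.
  by rewrite add_lfunE scale_lfunE !fE; apply: linl.
pose F : {linear U -> 'Hom(V, W)} :=
  HB.pack (fun x => linfun (f x)) (GRing.isLinear.Build _ _ _ _ _ lin).
by exists F => x y; rewrite -fE.
Qed.

Definition trilinear (U V W X : lmodType K) (f : U -> V -> W -> X) :=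
  [/\ forall y z, linear (fun x => f x y z),
      forall x z, linear (fun y => f x y z) & forall x y, linear (f x y)].

Lemma trilinear_curry (U V : lmodType K) (W X : vectType K)
    (f : U -> V -> W -> X) : trilinear f ->
  exists B : {bilinear U -> V -> 'Hom(W, X)}, forall x y z, B x y z = f x y z.
Proof.
move=> [lin1 lin2 lin3].
have fE x y : linfun (f x y) =1 f x y by apply/linear_linfunE/lin3.
have [|B BE] := @bilinear_exists U V 'Hom(W, X) (fun x y => linfun (f x y)).
  split=> y k u v; apply/lfunP=> z; rewrite add_lfunE scale_lfunE !fE.
    exact: lin1.
  exact: lin2.
by exists B => x y z; rewrite BE fE.
Qed.

Lemma surjective_section (V W : vectType K) (f : 'Hom(V, W)) :
  (forall w, exists v, f v = w) -> exists g : 'Hom(W, V), forall w, f (g w) = w.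
Proof.
move=> surj; exists (f^-1)%VF => w; apply: limg_lfunVK.
by have [v <-] := surj w; rewrite memv_img ?memvf.
Qed.

End LinearAlgebra.

(** * Nondegenerate symmetric forms *)

Section Form.
Context (K : fieldType) (V : vectType K) (b : {symmetric V}).

Lemma symDl x y z : b (x + y) z = b x z + b y z.
Proof. exact: linearDl. Qed.

Lemma symBl x y z : b (x - y) z = b x z - b y z.
Proof. exact: linearBl. Qed.

Lemma symNl x z : b (- x) z = - b x z.
Proof. exact: linearNl. Qed.

Lemma symNr x z : b x (- z) = - b x z.
Proof. exact: linearNr. Qed.

Lemma sym0l z : b 0 z = 0.
Proof. exact: linear0l. Qed.

Hypothesis nd : nondegenerate b.

Lemma nondegenerate_eq0 x : (forall y, b x y = 0) -> x = 0.
Proof.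
move: nd => /eqP radb x0; apply/eqP; rewrite -memv0 -radb.
by apply/mem_orthovP => y _.
Qed.

Lemma nondegenerate_inj x y : (forall z, b x z = b y z) -> x = y.
Proof.
move=> xy; apply/eqP; rewrite -subr_eq0; apply/eqP/nondegenerate_eq0 => z.
by rewrite symBl xy subrr.
Qed.

(** [x |-> b x _] is injective between spaces of the same dimension; its
    inverse provides a representative depending linearly on the form. *)
Lemma riesz : exists sharp : 'Hom('Hom(V, K^o), V),
  forall alpha v, b (sharp alpha) v = alpha v.
Proof.
have [|flat flatE] := @bilinear_curry K V V K^o b.
  by split=> z k x y /=; rewrite ?linearPl ?linearP.
have ker0 : lker (linfun flat) == 0%VS.
  rewrite -subv0; apply/subvP => x; rewrite memv_ker lfunE memv0 => /eqP fx.
  by apply/eqP/nondegenerate_eq0 => y; rewrite -[LHS]flatE fx zero_lfunE.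
have full : limg (linfun flat) = fullv.
  apply/eqP; rewrite eqEdim subvf /= limg_dim_eq; last first.
    by rewrite (eqP ker0) capv0.
  by rewrite !dimvf /dim /= muln1.
exists (linfun flat)^-1%VF => alpha v.
by rewrite -[LHS]flatE -[flat _]lfunE limg_lfunVK // full memvf.
Qed.

Lemma riesz_linear (U : vectType K) (f : U -> V -> K^o) :
  bilinear_for *:%R *:%R f ->
  exists s : 'Hom(U, V), forall u v, b (s u) v = f u v.
Proof.
have [sharp sharpE] := riesz => /bilinear_curry[F FE].
by exists (sharp \o linfun F)%VF => u v; rewrite comp_lfunE sharpE lfunE FE.
Qed.

Lemma riesz_bilinear (U U' : lmodType K) (f : U -> U' -> V -> K^o) :
  trilinear f ->
  exists B : {bilinear U -> U' -> V}, forall u u' v, b (B u u') v = f u u' v.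
Proof.
have [sharp sharpE] := riesz => /trilinear_curry[C CE].
have [|B BE] := @bilinear_exists K U U' V (fun u u' => sharp (C u u')).
  by split=> z k x y; rewrite ?linearPl !linearP.
by exists B => u u' v; rewrite BE sharpE CE.
Qed.

(** The projection [q = 1 - projv W] kills [W], so the form [b y (q _)] is
    represented by a vector orthogonal to [W]; pairing [x] with that vector
    gives [b y (q x) = 0] for all [y], whence [q x = 0]. *)
Lemma orthov_orthov (W : {vspace V}) : orthov b (orthov b W) = W.
Proof.
apply/eqP; rewrite eqEsubv; apply/andP; split; apply/subvP => x; last first.
  by move=> xW; apply/mem_orthovP => y /mem_orthovP yW; rewrite symC yW.
move=> /mem_orthovP xWW; pose q := (\1 - projv W)%VF.
have qE z : q z = z - projv W z by rewrite add_lfunE opp_lfunE id_lfunE.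
suff q0 : q x = 0.
  by move/eqP: q0; rewrite qE subr_eq0 => /eqP->; apply: memv_proj.
apply: nondegenerate_eq0 => y.
have [|s sE] := @riesz_linear V (fun u v => b u (q v)).
  by split=> z k u v /=; rewrite ?linearPl ?linearP.
rewrite symC -sE symC; apply: xWW; apply/mem_orthovP => w wW.
by rewrite sE qE projv_id // subrr linear0r.
Qed.

End Form.

(** * The ideal Leib and the core *)

Section SymmetricLeibniz.
Context (R : realType) (G : lquad_leibniz R).
Hypothesis sym : symmetric_leibniz (lmul G).

Local Notation "u *_g v" := (lmul G u v) (at level 40).
Local Notation "<{ u , v }>" := (metric G u v).
Local Notation I := (core_I G).
Local Notation Iperp := (core_Iperp G).
Local Notation A := (coreA G).
Local Notation h := (coreh G).
Local Notation pi := (qproj (core_Iperp G)).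
Local Notation "a *_A c" := (coreA_mul G a c) (at level 40).
Local Notation "<< a , c >>" := (coreA_form G a c).

(** The left Leibniz identity says that left multiplication by [v w] is the
    commutator of those by [v] and [w], hence antisymmetric in [v] and [w]. *)
Lemma leib_mul0 x u : x \in leib (lmul G) -> x *_g u = 0.
Proof.
move=> xL; suff /subvP/(_ x xL) : (leib (lmul G) <=
    lker (linfun (applyr (lmul G) u)))%VS.
  by rewrite memv_ker lfunE => /eqP.
apply: leib_ind => v w; rewrite memv_ker lfunE /= linearDl.
apply/eqP/(addIr (v *_g (w *_g u))).
by rewrite add0r -addrA -(lmul_left_leibniz w v u) -lmul_left_leibniz.
Qed.

(** Add the left identity for [v (w u)] to the right identity for [(v w) u]:
    the terms [(v w) u] and [v (w u)] cancel. *)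
Lemma mul_prod_anticomm w v u : w *_g (v *_g u) = - ((v *_g u) *_g w).
Proof.
have [left right] := sym; have := left v w u; rewrite (right u v w) addrAC.
rewrite -[LHS]add0r => /addIr/esym/eqP.
by rewrite addrC addr_eq0 => /eqP.
Qed.

Lemma mul_leib0 u x : x \in leib (lmul G) -> u *_g x = 0.
Proof.
move=> xL; suff /subvP/(_ x xL) : (leib (lmul G) <= lker (linfun (lmul G u)))%VS.
  by rewrite memv_ker lfunE => /eqP.
apply: leib_ind => v w; rewrite memv_ker lfunE /=.
rewrite linearDr !mul_prod_anticomm -opprD -linearDl oppr_eq0.
by apply/eqP/leib_mul0/leib_sum.
Qed.

Lemma leib_orth_mul x u v : x \in leib (lmul G) -> <{x, u *_g v}> = 0.
Proof. by move=> xL; rewrite symC lmul_skew mul_leib0 // linear0r oppr0. Qed.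

Lemma leib_isotropic : (leib (lmul G) <= orthov (metric G) (leib (lmul G)))%VS.
Proof.
apply: leib_ind => u v; apply/mem_orthovP => x xL.
by rewrite symC linearDr /= !leib_orth_mul // addr0.
Qed.

Lemma core_I_leib : I = leib (lmul G).
Proof. by apply/capv_idPl/leib_isotropic. Qed.

Lemma mul_mem u v : u *_g v \in Iperp.
Proof.
by apply/mem_orthovP => x; rewrite core_I_leib symC; apply: leib_orth_mul.
Qed.

Lemma Iperp_orth u x : u \in Iperp -> x \in I -> <{u, x}> = 0.
Proof. by move=> /mem_orthovP; apply. Qed.

Lemma I_Iperp x : x \in I -> x \in Iperp.
Proof.
rewrite core_I_leib /core_Iperp core_I_leib; exact: (subvP leib_isotropic).
Qed.

Lemma Iperp_perp x : (forall u, u \in Iperp -> <{x, u}> = 0) -> x \in I.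
Proof.
move=> xP; rewrite -(orthov_orthov (metric_nondeg G) I).
by apply/mem_orthovP => u; apply: xP.
Qed.

(** Products commute up to sign modulo [Leib], which [I^perp] cannot see. *)
Lemma mul_antisym_orth v u w : v \in Iperp -> <{v, u *_g w}> = - <{v, w *_g u}>.
Proof.
move=> vP; apply/eqP; rewrite -addr_eq0 -linearDr /=.
by apply/eqP; rewrite (Iperp_orth vP) // core_I_leib leib_sum.
Qed.

Lemma pi_eq0 u : (pi u == 0) = (u \in Iperp).
Proof. by rewrite -(raddf0 pi) eq_qproj subr0. Qed.

Lemma coreh_abelian (X Y : h) : coreh_mul G X Y = 0.
Proof. by apply/eqP; rewrite pi_eq0 mul_mem. Qed.

(** The projection [I^perp -> A], extended linearly to [G] so that it can be
    applied without carrying membership proofs; only its values on [I^perp]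
    are meaningful. *)
Definition core_class : G -> A := qproj (core_J G) \o vsproj Iperp.
HB.instance Definition _ := GRing.Linear.on core_class.

Local Notation cl := core_class.

Lemma clD u v : cl (u + v) = cl u + cl v.
Proof. exact: raddfD. Qed.

Lemma cl_eq0 u : u \in Iperp -> (cl u == 0) = (u \in I).
Proof.
move=> uP; rewrite -(raddf0 (qproj _)) eq_qproj subr0.
by rewrite -memv_preim lfunE /= vsprojK.
Qed.

Lemma cl_I u : u \in I -> cl u = 0.
Proof. by move=> uI; apply/eqP; rewrite cl_eq0 ?I_Iperp. Qed.

Lemma cl_mul u v : u \in Iperp -> v \in Iperp -> cl (u *_g v) = cl u *_A cl v.
Proof.
move=> uP vP; rewrite [RHS]quot_mulE; congr (qproj _ _).
by rewrite /= /sub_mul !vsprojK.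
Qed.

Lemma cl_form u v : u \in Iperp -> v \in Iperp -> <<cl u, cl v>> = <{u, v}>.
Proof. by move=> uP vP; rewrite [LHS]quot_formE /= /sub_form !vsprojK. Qed.

Lemma cl_repr a : exists2 u, u \in Iperp & a = cl u.
Proof.
exists (vsval (qrepr a)); first exact: subvsP.
by rewrite /cl /= vsvalK qreprK.
Qed.

Lemma cl_antisym u v : cl (u *_g v) = - cl (v *_g u).
Proof.
apply/eqP; rewrite -addr_eq0 -clD.
by apply/eqP/cl_I; rewrite core_I_leib leib_sum.
Qed.

Lemma coreA_nondeg : nondegenerate (coreA_form G).
Proof.
rewrite /nondegenerate -subv0; apply/subvP => a; have [u uP ->] := cl_repr a.
move=> /mem_orthovP u0; rewrite memv0 cl_eq0 //; apply: Iperp_perp => v vP.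
by rewrite -cl_form // u0 ?memvf.
Qed.

Lemma coreA_antisym a c : a *_A c = - (c *_A a).
Proof.
have [u uP ->] := cl_repr a; have [v vP ->] := cl_repr c.
by rewrite -!cl_mul // cl_antisym.
Qed.

Lemma coreA_skew a : skew_endo (coreA_form G) (coreA_mul G a).
Proof.
have [w wP ->] := cl_repr a => b c.
have [u uP ->] := cl_repr b; have [v vP ->] := cl_repr c.
by rewrite -!cl_mul // !cl_form ?mul_mem // lmul_skew.
Qed.

Lemma coreA_quadratic_lie : quadratic_lie (coreA_mul G) (coreA_form G).
Proof.
split; [split | exact: coreA_nondeg | exact: coreA_skew].
  move=> a; have /eqP := coreA_antisym a a.
  rewrite -addr_eq0 -mulr2n -scaler_nat scaler_eq0 pnatr_eq0 /=.
  exact: eqP.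
move=> a b c; rewrite (coreA_antisym c (a *_A b)) (coreA_antisym c a) linearNr.
have [u uP ->] := cl_repr a; have [v vP ->] := cl_repr b.
have [w wP ->] := cl_repr c.
rewrite -(cl_mul vP wP) -(cl_mul uP wP) -(cl_mul uP vP) -!cl_mul ?mul_mem //.
by rewrite (lmul_left_leibniz u) clD addrK subrr.
Qed.

(** * Isotropic sections and the structure maps *)

(** Subtract from a section [s0] the map [tau] to [I] with
    [<tau X, u> = 1/2 <s0 X, s0 (pi u)>].  Both cross terms of
    [<s0 X - tau X, s0 Y - tau Y>] equal half of [<s0 X, s0 Y>], and [I] is
    isotropic. *)
Lemma isotropic_section : exists s : 'Hom(h, G),
  (forall X, pi (s X) = X) /\ (forall X Y, <{s X, s Y}> = 0).
Proof.
have [X|s0 s0K] := @surjective_section _ G h (linfun pi).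
  by exists (qrepr X); rewrite lfunE /= qreprK.
have {}s0K X : pi (s0 X) = X by rewrite -[RHS]s0K lfunE.
pose half_gram (X : h) (u : G) : R^o := 2^-1 * <{s0 X, s0 (pi u)}>.
have [|tau tauE] := riesz_linear (metric_nondeg G) (f := half_gram).
  by split=> z k x y; rewrite /half_gram !linearP /= ?linearPl /= ?linearPr /=;
     rewrite /GRing.scale /=; ring.
have tauI X : tau X \in I.
  apply: Iperp_perp => u; rewrite -pi_eq0 => /eqP u0.
  by rewrite tauE /half_gram u0 !linear0 mulr0.
exists (s0 - tau)%VF; split=> [X | X Y]; rewrite !add_lfunE !opp_lfunE.
  rewrite raddfB /= s0K; have /eqP-> : pi (tau X) == 0 by rewrite pi_eq0 I_Iperp.
  by rewrite subr0.
rewrite linearBl /= !linearBr /= (symC _ (s0 X) (tau Y)) !tauE /half_gram !s0K.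
rewrite (symC _ (s0 Y)); have /eqP-> : pi (tau Y) == 0 by rewrite pi_eq0 I_Iperp.
by rewrite linear0 linear0r; field.
Qed.

Lemma linear_lift : exists t : 'Hom(A, G),
  (forall a, t a \in Iperp) /\ (forall a, cl (t a) = a).
Proof.
have [a|t tK] :=
  @surjective_section _ (subvs_of Iperp) A (linfun (qproj (core_J G))).
  by exists (qrepr a); rewrite lfunE /= qreprK.
exists (linfun vsval \o t)%VF; split=> a; rewrite comp_lfunE lfunE /=.
  exact: subvsP.
by rewrite /cl /= vsvalK -[RHS]tK lfunE.
Qed.

Section Data.
Context (s : 'Hom(h, G)) (t : 'Hom(A, G)).
Hypothesis sK : forall X, pi (s X) = X.
Hypothesis s_iso : forall X Y, <{s X, s Y}> = 0.
Hypothesis tP : forall a, t a \in Iperp.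
Hypothesis tK : forall a, cl (t a) = a.

Lemma lift_cl u : u \in Iperp -> u - t (cl u) \in I.
Proof.
by move=> uP; rewrite -cl_eq0 ?rpredB // raddfB /= tK subrr.
Qed.

(** As [I] multiplies to zero on both sides, products with elements of [A] do
    not depend on the lift. *)
Lemma mul_lift_cl w u : u \in Iperp -> w *_g t (cl u) = w *_g u.
Proof.
move=> uP; apply/eqP; rewrite eq_sym -subr_eq0 -linearBr.
by apply/eqP/mul_leib0; rewrite -core_I_leib lift_cl.
Qed.

Lemma lift_cl_mul w u : u \in Iperp -> t (cl u) *_g w = u *_g w.
Proof.
move=> uP; apply/eqP; rewrite eq_sym -subr_eq0 -linearBl.
by apply/eqP/leib_mul0; rewrite -core_I_leib lift_cl.
Qed.

Lemma F_exists : exists F : {linear h -> 'End(A)},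
  forall X u, u \in Iperp -> F X (cl u) = cl (s X *_g u).
Proof.
have [|F FE] := @bilinear_curry _ h A A (fun X a => cl (s X *_g t a)).
  by split=> z k x y; rewrite linearP ?linearPl ?linearPr /= linearP.
by exists F => X u uP; rewrite FE mul_lift_cl.
Qed.

Lemma theta_exists : exists theta : {bilinear h -> h -> A},
  forall X Y, theta X Y = cl (s X *_g s Y).
Proof.
apply: bilinear_exists.
by split=> z k x y; rewrite linearP ?linearPl ?linearPr /= linearP.
Qed.

Lemma omega_exists : exists omega : {bilinear h -> h -> A},
  forall X Y u, u \in Iperp -> <<omega X Y, cl u>> = - <{u *_g s X, s Y}>.
Proof.
have [|omega omegaE] := riesz_bilinear coreA_nondeg
  (f := fun (X Y : h) (a : A) => - <{t a *_g s X, s Y}> : R^o).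
  by split=> X Y k x y; rewrite linearP ?linearPl ?linearPr /= ?linearPl /=;
     rewrite /GRing.scale /=; ring.
by exists omega => X Y u uP; rewrite omegaE lift_cl_mul.
Qed.

Lemma Omega_exists : exists Omega : {linear h -> 'Hom(h, dual h)},
  forall X Y Z, Omega X Y Z = <{s X *_g s Y, s Z}>.
Proof.
have [|C CE] := @trilinear_curry _ h h h R^o
  (fun X Y Z => <{s X *_g s Y, s Z}>).
  by split=> X Y k x y; rewrite linearP ?linearPl ?linearPr /= ?linearPl.
have [|Omega OmegaE] := @bilinear_curry _ h h (dual h) C.
  by split=> X k x y; rewrite ?linearPl ?linearPr.
by exists Omega => X Y Z; rewrite OmegaE CE.
Qed.

(** * The structure equations *)

Section Cocycles.
Context (F : {linear h -> 'End(A)}) (theta omega : {bilinear h -> h -> A}).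
Context (Omega : {linear h -> 'Hom(h, dual h)}).
Hypothesis FE : forall X u, u \in Iperp -> F X (cl u) = cl (s X *_g u).
Hypothesis thetaE : forall X Y, theta X Y = cl (s X *_g s Y).
Hypothesis omegaE :
  forall X Y u, u \in Iperp -> <<omega X Y, cl u>> = - <{u *_g s X, s Y}>.
Hypothesis OmegaE : forall X Y Z, Omega X Y Z = <{s X *_g s Y, s Z}>.

Lemma F_skew X : skew_endo (coreA_form G) (F X).
Proof.
move=> a c; have [u uP ->] := cl_repr a; have [v vP ->] := cl_repr c.
by rewrite !FE // !cl_form ?mul_mem // lmul_skew.
Qed.

Lemma F_derivation X : derivation (coreA_mul G) (F X).
Proof.
move=> a c; have [u uP ->] := cl_repr a; have [v vP ->] := cl_repr c.
rewrite -(cl_mul uP vP) !FE ?mul_mem // -!cl_mul ?mul_mem //.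
by rewrite lmul_left_leibniz clD.
Qed.

Lemma theta_skew X Y : theta X Y = - theta Y X.
Proof. by rewrite !thetaE cl_antisym. Qed.

Lemma omega_skew X Y : omega X Y = - omega Y X.
Proof.
apply: (nondegenerate_inj coreA_nondeg) => a; have [u uP ->] := cl_repr a.
by rewrite symNl !omegaE // lmul_skew (symC _ (s X)).
Qed.

Lemma Omega_wedge2 X : wedge2 (Omega X).
Proof. by move=> Y Z; rewrite !OmegaE lmul_skew (symC _ (s Y)). Qed.

Lemma cl_mul_section u X : u \in Iperp -> cl (u *_g s X) = - F X (cl u).
Proof. by move=> uP; rewrite FE // cl_antisym. Qed.

Lemma ad_theta X Y a : theta X Y *_A a = F X (F Y a) - F Y (F X a).
Proof.
have [u uP ->] := cl_repr a; rewrite thetaE -cl_mul ?mul_mem // !FE ?mul_mem //.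
by rewrite (lmul_left_leibniz (s X)) clD addrK.
Qed.

Lemma form_mul_section u v X Y : u \in Iperp -> v \in Iperp ->
  <{u *_g s X, v *_g s Y}> = <<F X (cl u), F Y (cl v)>>.
Proof.
move=> uP vP; rewrite -cl_form ?mul_mem // !cl_mul_section //.
by rewrite symNl symNr opprK.
Qed.

Lemma form_theta_mul_section u X Y Z : u \in Iperp ->
  <{s X *_g s Y, u *_g s Z}> = - <<theta X Y, F Z (cl u)>>.
Proof.
by move=> uP; rewrite -cl_form ?mul_mem // (cl_mul_section _ uP) thetaE symNr.
Qed.

Lemma form_theta X Y Z T :
  <{s X *_g s Y, s Z *_g s T}> = <<theta X Y, theta Z T>>.
Proof. by rewrite !thetaE cl_form ?mul_mem. Qed.

(** Paired with [c], [omega X Y *_A a] becomes [- <(a c) * s X, s Y>]; splitting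
    [(a c) * s X] with the left Leibniz identity leaves two scalar products
    of the form computed in [form_mul_section]. *)
Lemma ad_omega X Y a : - (omega X Y *_A a) = F X (F Y a) - F Y (F X a).
Proof.
apply: (nondegenerate_inj coreA_nondeg) => c.
have [u uP ->] := cl_repr a; have [v vP ->] := cl_repr c.
rewrite -coreA_antisym coreA_skew -(cl_mul uP vP) omegaE ?mul_mem // opprK.
have -> : (u *_g v) *_g s X = u *_g (v *_g s X) - v *_g (u *_g s X).
  by rewrite (lmul_left_leibniz u) addrK.
rewrite symBl (lmul_skew v) (lmul_skew u (_ *_g s X)) !form_mul_section //.
rewrite symBl (F_skew X (F Y _)) (F_skew Y (F X _)).
by rewrite (symC _ (F Y _)).
Qed.

Lemma F_theta_cyclic X Y Z :
  F X (theta Y Z) + F Y (theta Z X) + F Z (theta X Y) = 0.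
Proof.
rewrite (theta_skew Z) linearN /= !thetaE !FE ?mul_mem //.
rewrite (cl_antisym (s Z)) (lmul_left_leibniz (s X)) clD.
by rewrite addrK subrr.
Qed.

(** Against [a], the [omega] part is [<(s X * a) * s Y, s Z>]; the left
    Leibniz identity turns it into [theta] terms, and the sum is the cyclic
    identity [F_theta_cyclic] paired with [a]. *)
Lemma F_theta_omega X Y Z : F X (theta Y Z + omega Y Z) = 0.
Proof.
apply: (nondegenerate_eq0 coreA_nondeg) => a; have [u uP ->] := cl_repr a.
rewrite linearD symDl !(F_skew X) [in X in _ + X]FE // omegaE ?mul_mem //.
have -> : (s X *_g u) *_g s Y = s X *_g (u *_g s Y) - u *_g (s X *_g s Y).
  by rewrite (lmul_left_leibniz (s X)) addrK.
rewrite symBl (lmul_skew u) (lmul_skew (s X) (u *_g _)).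
rewrite form_theta_mul_section // opprK.
rewrite (symC (metric G)) form_theta_mul_section // !opprK.
have : <<F X (theta Y Z) + F Y (theta Z X) + F Z (theta X Y), cl u>> = 0.
  by rewrite F_theta_cyclic sym0l.
rewrite !symDl !F_skew (theta_skew Z) symNl.
lra.
Qed.

(** Here [mul_prod_anticomm] moves the product [s Y * s Z] to the right of
    [s X], where skewness of left multiplications applies. *)
Lemma omega_theta X T Y Z : <<omega X T, theta Y Z>> = - <<theta X T, theta Y Z>>.
Proof.
rewrite (thetaE Y Z) omegaE ?mul_mem // -symNl.
by rewrite -mul_prod_anticomm lmul_skew form_theta -thetaE (symC (coreA_form G)).
Qed.

Lemma theta_omega_theta X Y Z T : <<theta X T + omega X T, theta Y Z>> = 0.
Proof. by rewrite symDl omega_theta subrr. Qed.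

(** The left Leibniz identity on [s X], [s Y], [s Z] paired with [s T]; its
    middle term is an [omega]-[theta] product, converted by [omega_theta]. *)
Lemma theta_theta_cyclic X Y Z T :
  <<theta Y T, theta Z X>> + <<theta X T, theta Y Z>>
  + <<theta Z T, theta X Y>> = 0.
Proof.
have := congr1 (fun u => <{u, s T}>) (lmul_left_leibniz (s X) (s Y) (s Z)).
rewrite /= symDl (lmul_skew (s Y)) (lmul_skew (s X) (s Y *_g _)).
rewrite -[<{(_ *_g _) *_g _, _}>]opprK -omegaE ?mul_mem // -thetaE omega_theta.
rewrite !form_theta (symC _ (theta X Z)) (theta_skew X Z) symNr.
rewrite (symC _ (theta Y Z)); lra.
Qed.

(** * The isomorphism with the model *)

Local Notation model_prod :=
  (model_mul (coreA_mul G) (coreA_form G) F Omega theta omega).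

Lemma Iperp_part u : u - s (pi u) \in Iperp.
Proof. by rewrite -pi_eq0 raddfB /= sK subrr. Qed.

Lemma coordinates_exist : exists f : 'Hom(G, model h A),
  forall u, exists2 alpha : dual h, f u = (pi u, cl (u - s (pi u)), alpha) &
    forall Y, alpha Y = <{u, s Y}>.
Proof.
have [|flat flatE] := @bilinear_curry _ G h R^o (fun u Y => <{u, s Y}>).
  by split=> z k x y; rewrite ?linearP ?linearPl ?linearPr.
have lin : linear (fun u : G => (pi u, cl (u - s (pi u)), flat u) : model h A).
  move=> k u v; rewrite !linearP /=.
  have -> : k *: u + v + (k *: - s (pi u) - s (pi v)) =
      k *: (u - s (pi u)) + (v - s (pi v)).
    by rewrite scalerDr addrACA.
  by rewrite linearP.
exists (linfun (fun u : G => (pi u, cl (u - s (pi u)), flat u) : model h A)) => u.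
by exists (flat u) => [|Y]; rewrite ?flatE // linear_linfunE.
Qed.

Lemma coordinates_isometric_iso :
  isometric_iso (lmul G) (metric G) model_prod (@model_form R h A (coreA_form G)).
Proof.
have [f fE] := coordinates_exist; exists f.
have isom u v : model_form (coreA_form G) (f u) (f v) = <{u, v}>.
  have [alpha -> alphaE] := fE u; have [beta -> betaE] := fE v.
  rewrite /model_form alphaE betaE cl_form ?Iperp_part //.
  rewrite !symBl !(symC _ _ (_ - _)) !symBl s_iso.
  rewrite (symC _ v u) (symC _ (s _) u); lra.
split=> [ | u v | ]; last exact: isom.
  have injf : injective f.
    move=> u v fuv; apply: (nondegenerate_inj (metric_nondeg G)) => w.
    by rewrite -!isom fuv.
  have surjf w : exists u, f u = w.
    case: w => [[X a] alpha].
    (* The correction [z] in [I] must give [s X + t a + z] the pairing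
       [alpha] with the image of [s]. *)
    have [sharp sharpE] := riesz (metric_nondeg G).
    pose phi (u : G) : R^o := alpha (pi u) - <{t a, s (pi u)}>.
    have phiE : linfun phi =1 phi.
      apply: linear_linfunE => k x y; rewrite /phi !linearP /=.
      by rewrite /GRing.scale /=; ring.
    pose z := sharp (linfun phi).
    have zE v : <{z, v}> = phi v by rewrite /z sharpE phiE.
    have zI : z \in I.
      apply: Iperp_perp => v; rewrite -pi_eq0 => /eqP v0.
      by rewrite zE /phi v0 !linear0 subrr.
    exists (s X + t a + z); have [beta -> betaE] := fE (s X + t a + z).
    have -> : pi (s X + t a + z) = X.
      have /eqP ta0 : pi (t a) == 0 by rewrite pi_eq0.
      have /eqP z0 : pi z == 0 by rewrite pi_eq0 I_Iperp.
      by rewrite !raddfD /= sK ta0 z0 !addr0.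
    congr (_, _, _).
      by rewrite -(addrA (s X)) (addrC _ (- s X)) addKr clD tK (cl_I zI) addr0.
    apply/lfunP => Y; rewrite betaE !symDl zE /phi sK s_iso; lra.
  have [g gK] := surjective_section surjf.
  by exists g => // u; apply: injf; rewrite gK.
(* Multiplicativity: expand [(s X + u') (s Y + v')]. *)
have [gamma -> gammaE] := fE (u *_g v).
have [alpha -> _] := fE u; have [beta -> _] := fE v.
rewrite /model_mul; set X := pi u; set Y := pi v.
have /eqP uv0 : pi (u *_g v) == 0 by rewrite pi_eq0 mul_mem.
rewrite uv0 linear0 subr0.
set u' := u - s X; set v' := v - s Y.
have uP : u' \in Iperp := Iperp_part u; have vP : v' \in Iperp := Iperp_part v.
have uvE : u *_g v = (s X *_g s Y + s X *_g v') + (u' *_g s Y + u' *_g v').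
  rewrite -!linearDr /= addrCA subrr addr0.
  by rewrite -linearDl /= addrCA subrr addr0.
clearbody u' v'; congr (_, _, _).
  rewrite uvE !clD -thetaE -FE // (cl_mul_section _ uP) (cl_mul uP vP).
  by rewrite [X in _ + X]addrC addrA; congr (_ + _); apply: addrAC.
apply/lfunP => Z; rewrite gammaE uvE !symDl !add_lfunE OmegaE muE nuE rhoE.
rewrite (omegaE _ _ uP) (FE _ uP) thetaE !cl_form ?mul_mem //.
rewrite (lmul_skew (s X) v') (lmul_skew u' v') (mul_antisym_orth u' _ vP).
rewrite !(symC _ v'); lra.
Qed.

End Cocycles.
End Data.

End SymmetricLeibniz.

Theorem theorem6p3 (R : realType) (G : lquad_leibniz R) :
  symmetric_leibniz (lmul G) ->
  [/\ (leib (lmul G) <= orthov (metric G) (leib (lmul G)))%VS,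
      quadratic_lie (coreA_mul G) (coreA_form G),
      forall X Y : coreh G, coreh_mul G X Y = 0 &
      exists (F : {linear coreh G -> 'End(coreA G)})
             (Omega : {linear coreh G -> 'Hom(coreh G, dual (coreh G))})
             (theta omega : {bilinear coreh G -> coreh G -> coreA G}),
        [/\ (forall X, skew_endo (coreA_form G) (F X)) /\
            (forall X, derivation (coreA_mul G) (F X)),
            forall X, wedge2 (Omega X),
            (forall X Y, theta X Y = - theta Y X) /\
            (forall X Y, omega X Y = - omega Y X),
            isometric_iso (lmul G) (metric G)
              (model_mul (coreA_mul G) (coreA_form G) F Omega theta omega)
              (model_form (coreA_form G)) &
            forall X Y Z T : coreh G,
            [/\ forall a, coreA_mul G (theta X Y) a = F X (F Y a) - F Y (F X a) /\
                          - coreA_mul G (omega X Y) a = F X (F Y a) - F Y (F X a),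
                F X (theta Y Z) + F Y (theta Z X) + F Z (theta X Y) = 0,
                F X (theta Y Z + omega Y Z) = 0,
                coreA_form G (theta Y T) (theta Z X)
                + coreA_form G (theta X T) (theta Y Z)
                + coreA_form G (theta Z T) (theta X Y) = 0 &
                coreA_form G (theta X T + omega X T) (theta Y Z) = 0]]].
Proof.
move=> sym; split.
- exact: leib_isotropic.
- exact: coreA_quadratic_lie.
- exact: coreh_abelian.
have [s [sK s_iso]] := isotropic_section sym.
have [t [tP tK]] := linear_lift G.
have [F FE] := F_exists sym s tP tK.
have [theta thetaE] := theta_exists s.
have [omega omegaE] := omega_exists sym s tP tK.
have [Omega OmegaE] := Omega_exists s.
exists F, Omega, theta, omega; split.
- by split; [apply: (F_skew sym FE) | apply: (F_derivation sym FE)].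
- exact: (Omega_wedge2 OmegaE).
- by split; [apply: (theta_skew sym thetaE) | apply: (omega_skew omegaE)].
- exact: (coordinates_isometric_iso sym sK s_iso tP tK FE thetaE omegaE OmegaE).
move=> X Y Z T; split.
- move=> a; split; first exact: (ad_theta sym FE thetaE).
  exact: (ad_omega sym FE omegaE).
- exact: (F_theta_cyclic sym FE thetaE).
- exact: (F_theta_omega sym FE thetaE omegaE).
- exact: (theta_theta_cyclic sym thetaE omegaE).
- exact: (theta_omega_theta sym thetaE omegaE).
Qed.
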